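(* Let $d\ge2$ and let $\{Q_j\}_{j=1}^{d^2}$ be an NQPR in dimension $d$. Then its unitary negativity satisfies $$1\le N_{\mathrm U}(\{Q_j\})\le d-\frac{2}{d}.$$ The lower bound is attained if and only if there is a SIC $\{\Pi_j\}_{j=1}^{d^2}$ such that either $Q_j=Q_j^-$ for all $j$ or $Q_j=Q_j^+$ for all $j$.
   Context: An NQPR in dimension $d$ is a family $\{Q_j\}_{j=1}^{d^2}$ of Hermitian operators on $\mathbb{C}^d$ with $\operatorname{tr}(Q_j)=1$ and $\operatorname{tr}(Q_jQ_k)=d\,\delta_{jk}$. For a unitary $U$ on $\mathbb{C}^d$, define the $d^2\times d^2$ matrix $U^Q_{jk}=\operatorname{tr}(Q_jUQ_kU^\dagger)/d$ and the unitary negativity $N_{\mathrm U}(U)=-d\min_{j,k}U^Q_{jk}$; the unitary negativity $N_{\mathrm U}(\{Q_j\})$ of the NQPR is the maximum of $N_{\mathrm U}(U)$ over all unitaries $U$. A SIC in dimension $d$ is a set $\{\Pi_j\}_{j=1}^{d^2}$ of rank-one projectors with $\operatorname{tr}(\Pi_j\Pi_k)=(d\delta_{jk}+1)/(d+1)$; given a SIC, $Q_j^\pm=\mp\sqrt{d+1}\,\Pi_j+\frac{1}{d}(1\pm\sqrt{d+1})$, with $1$ the identity in the operator term. *)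

(* Defs.v *)
From HB Require Import structures.
From mathcomp Require Import all_boot all_order all_algebra.
From mathcomp Require Import classical_sets reals.
From mathcomp Require Import complex.

Set Implicit Arguments.
Unset Strict Implicit.
Unset Printing Implicit Defensive.

Import Order.TTheory GRing.Theory Num.Theory.
Local Open Scope ring_scope.
Local Open Scope classical_set_scope.

Section NQPR.
Variable R : realType.
Local Notation C := R[i].

Definition adjmx (n : nat) (A : 'M[C]_n) : 'M[C]_n :=
  (map_mx (fun z : C => conjc z) A)^T.

Definition hermitian (n : nat) (A : 'M[C]_n) : Prop := adjmx A = A.

Definition unitary (n : nat) (U : 'M[C]_n) : Prop := U *m adjmx U = 1%:M.

Definition is_NQPR (d : nat) (Q : 'I_(d ^ 2) -> 'M[C]_d) : Prop :=
  (forall j, hermitian (Q j)) /\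
  (forall j, \tr (Q j) = 1) /\
  (forall j k, \tr (Q j *m Q k) = (d%:R * (j == k)%:R)).

(* U^Q_{jk} = tr(Q_j U Q_k U^dagger)/d; this trace is real (the operators are
   Hermitian), so we take its real part to land in R. *)
Definition UQ (d : nat) (Q : 'I_(d ^ 2) -> 'M[C]_d) (U : 'M[C]_d)
    (j k : 'I_(d ^ 2)) : R :=
  complex.Re (\tr (Q j *m U *m Q k *m adjmx U)) / d%:R.

(* N_U(U) = - d * min_{j,k} U^Q_{jk} (min of a finite set = its infimum) *)
Definition NU_unitary (d : nat) (Q : 'I_(d ^ 2) -> 'M[C]_d) (U : 'M[C]_d) : R :=
  - (d%:R * inf [set UQ Q U j k | j in setT & k in setT]).

(* N_U({Q_j}) = max over unitaries of N_U(U) (max = supremum of the set) *)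
Definition NU (d : nat) (Q : 'I_(d ^ 2) -> 'M[C]_d) : R :=
  sup [set NU_unitary Q U | U in [set U | unitary U]].

Definition is_SIC (d : nat) (Pi : 'I_(d ^ 2) -> 'M[C]_d) : Prop :=
  (forall j, hermitian (Pi j)) /\
  (forall j, Pi j *m Pi j = Pi j) /\
  (forall j, \rank (Pi j) = 1%N) /\
  (forall j k, \tr (Pi j *m Pi k) =
                 (d%:R * (j == k)%:R + 1) / (d%:R + 1)).

Local Open Scope complex_scope.
Definition sqrt_dp1 (d : nat) : C := (Num.sqrt (d%:R + 1 : R))%:C.

Definition Qplus (d : nat) (Pi : 'I_(d ^ 2) -> 'M[C]_d) (j : 'I_(d ^ 2))
  : 'M[C]_d :=
  - (sqrt_dp1 d) *: Pi j + ((1 + sqrt_dp1 d) / d%:R)%:M.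

Definition Qminus (d : nat) (Pi : 'I_(d ^ 2) -> 'M[C]_d) (j : 'I_(d ^ 2))
  : 'M[C]_d :=
  (sqrt_dp1 d) *: Pi j + ((1 - sqrt_dp1 d) / d%:R)%:M.

End NQPR.

(* Main.v *)
Require Import Defs.
From HB Require Import structures.
From mathcomp Require Import all_boot all_order all_algebra.
From mathcomp Require Import classical_sets reals.
From mathcomp Require Import complex.
From mathcomp Require Import fingroup perm spectral ring lra.
Set Implicit Arguments.
Unset Strict Implicit.
Unset Printing Implicit Defensive.
Import Order.TTheory GRing.Theory Num.Theory.
Local Open Scope ring_scope.

(** Up to unitary conjugation only the spectra matter: if [Q_j] has eigenvalues
    [l], the unitary permuting its eigenbasis by [s] gives the overlap
    [f s = \sum_i l i * l (s i)].  Since [\sum_i l i = 1] and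
    [\sum_i l i ^+ 2 = d], the [d - 1] nontrivial cyclic shifts have average
    overlap [-1], whence the lower bound.  If it is attained, every cyclic shift
    minimises [f] for every labelling of the eigenvalues.  Label them increasingly
    and compose the shift by one with the transposition of [0] and [d - 2]:
    minimality gives [(l_0 - l_(d-2)) * (l_1 - l_(d-1)) <= 0], so all eigenvalues
    but the smallest or the largest coincide, and [Q_j] is an affine function of
    a rank-one projector.  Aligning two such operators of opposite sign would
    yield the overlap [-d + 2/d], which is less than [-1] for [d >= 3].  The upper
    bound is [tr ((Q_j + U Q_k U^* - 2/d)^2) >= 0]. *)

(** * Overlaps of a real spectrum with its own permutations *)

Section CyclicShifts.
Variables (R : realFieldType) (m : nat) (l : 'I_m.+2 -> R).

Definition perm_corr (s : 'S_m.+2) : R := \sum_i l i * l (s i).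

Definition shift_perm (a : 'I_m.+2) : 'S_m.+2 := perm (@addIr _ a).

(** For fixed [i] the index [i + a] runs over all indices as [a] does, so the sum over all shifts
    factors; the shift by 0 accounts for the squares. *)
Lemma sum_shift_corr :
  \sum_(a | a != 0) perm_corr (shift_perm a) = (\sum_i l i) ^+ 2 - \sum_i l i ^+ 2.
Proof.
have E0 : perm_corr (shift_perm 0) = \sum_i l i ^+ 2.
  by apply: eq_bigr => i _; rewrite permE addr0 expr2.
have ET : \sum_a perm_corr (shift_perm a) = (\sum_i l i) ^+ 2; last first.
  by rewrite -E0 -ET [in RHS](bigD1 0) //= addrAC subrr add0r.
rewrite /perm_corr exchange_big expr2 mulr_suml /=; apply: eq_bigr => i _.
rewrite -mulr_sumr; congr (_ * _).
rewrite [RHS](reindex_inj (@addrI _ i)) /=.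
by apply: eq_bigr => a _; rewrite permE.
Qed.

Hypothesis sum_l : \sum_i l i = 1.
Hypothesis sum_sqr_l : \sum_i l i ^+ 2 = m.+2%:R.

(* The [m.+1] nonzero shifts have total correlation [1 - d = - m.+1]. *)
Lemma sum_shift_corr1 : \sum_(a | a != 0) (perm_corr (shift_perm a) + 1) = 0.
Proof.
rewrite big_split /= sum_shift_corr sum_l sum_sqr_l sumr_const.
have -> : #|[pred a : 'I_m.+2 | a != 0]| = m.+1.
  by rewrite (cardC1 (0 : 'I_m.+2)) card_ord.
by rewrite expr1n -[in m.+2%:R]natr1; ring.
Qed.

Lemma perm_corr_le_N1 : exists s, perm_corr s <= -1.
Proof.
(* A nonzero shift must exist: only a nonempty sum of positive terms contradicts a vanishing
   total. *)
have nz : (inord 1 : 'I_m.+2) != 0 by rewrite -val_eqE /= inordK.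
have [/existsP[a Ha]|/existsPn H] :=
  boolP [exists a : 'I_m.+2, perm_corr (shift_perm a) <= -1].
  by exists (shift_perm a).
have Hpos (a : 'I_m.+2) : 0 < perm_corr (shift_perm a) + 1.
  by have := H a; rewrite -ltNge; lra.
have := sum_shift_corr1; rewrite (bigD1 (inord 1)) //= => E.
have : 0 <= \sum_(i | (i != 0) && (i != inord 1)) (perm_corr (shift_perm i) + 1).
  by apply: sumr_ge0 => i _; apply: ltW.
by have := Hpos (inord 1); lra.
Qed.

Hypothesis corr_ge : forall s, -1 <= perm_corr s.

Lemma shift_corr_eq_N1 (a : 'I_m.+2) : a != 0 -> perm_corr (shift_perm a) = -1.
Proof.
move=> a0; have ge0 b : 0 <= perm_corr (shift_perm b) + 1.
  by have := corr_ge (shift_perm b); lra.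
have := sum_shift_corr1; rewrite (bigD1 a) //= => E.
have : 0 <= \sum_(i | (i != 0) && (i != a)) (perm_corr (shift_perm i) + 1).
  by apply: sumr_ge0.
by have := ge0 a; lra.
Qed.

(** In [tperm i j * s] the transposition acts first, so only the partners of [l i] and [l j] are
    exchanged. *)
Lemma perm_corr_tperm (i j : 'I_m.+2) (s : 'S_m.+2) :
  perm_corr (tperm i j * s) = perm_corr s - (l i - l j) * (l (s i) - l (s j)).
Proof.
have [->|ij] := eqVneq i j; first by rewrite tperm1 mul1g; ring.
rewrite /perm_corr (bigD1 i) // (bigD1 j) /=; last by rewrite eq_sym.
rewrite [in RHS](bigD1 i) // [in RHS](bigD1 j) /=; last by rewrite eq_sym.
rewrite !permM tpermL tpermR.
under eq_bigr => k /andP[ki kj] do rewrite permM tpermD 1?eq_sym //.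
ring.
Qed.

(* A minimising permutation must order [l] oppositely, since otherwise a
   transposition would decrease the correlation further. *)
Lemma shift_opposite (i j a : 'I_m.+2) : a != 0 ->
  (l i - l j) * (l (i + a) - l (j + a)) <= 0.
Proof.
move=> a0; have := corr_ge (tperm i j * shift_perm a).
by rewrite perm_corr_tperm shift_corr_eq_N1 // !permE; lra.
Qed.

End CyclicShifts.

(** * Spectra whose permuted overlaps never drop below -1 *)

Section Rigidity.
Variables (R : realFieldType) (m : nat).
Implicit Types l : 'I_m.+2 -> R.

Lemma sorting_perm l :
  exists p : 'S_m.+2, forall i j : 'I_m.+2, (i <= j)%N -> l (p i) <= l (p j).
Proof.
pose t := [tuple l i | i < m.+2].
have /tuple_permP[p Hp] : perm_eq (sort <=%O t) t by rewrite perm_sort.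
exists p => i j ij.
have E k : l (p k) = nth 0 (sort <=%O t) k.
  by rewrite Hp -tnth_nth !tnth_mktuple.
have S : size (sort <=%O t) = m.+2 by rewrite size_sort size_tuple.
rewrite !E; apply: (sorted_leq_nth le_trans le_refl) => //; last 2 first.
- by rewrite inE S.
- by rewrite inE S.
exact: sort_le_sorted.
Qed.

(** Relabelling conjugates the permutation, so a bound over all permutations survives sorting. *)
Lemma perm_corr_relabel l (p s : 'S_m.+2) :
  perm_corr (l \o p) s = perm_corr l (p^-1 * s * p).
Proof.
rewrite /perm_corr [RHS](reindex_inj (@perm_inj _ p)) /=.
by apply: eq_bigr => i _; rewrite !permM permK.
Qed.

Lemma all_but_one_eq l : \sum_i l i = 1 -> \sum_i l i ^+ 2 = m.+2%:R ->
  (forall s, -1 <= perm_corr l s) ->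
  exists i0 y, forall i, i != i0 -> l i = y.
Proof.
move=> s1 s2 cge; have [p Hp] := sorting_perm l.
pose k := l \o p.
have k1 : \sum_i k i = 1 by rewrite -s1 [RHS](reindex_inj (@perm_inj _ p)).
have k2 : \sum_i k i ^+ 2 = m.+2%:R.
  by rewrite -s2 [RHS](reindex_inj (@perm_inj _ p)).
have kge s : -1 <= perm_corr k s by rewrite perm_corr_relabel.
(* The shift by [o] sends 0 to [o] and [q], the last index but one, to [ord_max]. For [m = 0] the
   index [q] is 0. *)
pose o : 'I_m.+2 := inord 1; pose q : 'I_m.+2 := inord m.
have o1 : o = 1%N :> nat by rewrite /o inordK.
have qm : q = m :> nat by rewrite /q inordK // ltnS.
have oN0 : o != 0 by rewrite -val_eqE /= o1.
have := shift_opposite k1 k2 kge 0 q oN0.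
have -> : (0 : 'I_m.+2) + o = o by rewrite add0r.
have -> : q + o = ord_max.
  by apply: val_inj; rewrite /= qm o1 addn1 modn_small.
have h1 : k 0 <= k q by apply: Hp.
have h2 : k o <= k ord_max by apply: Hp; rewrite -ltnS.
move=> h.
(* Sorting makes both differences nonpositive, so their product is nonnegative; with [h] it
   vanishes. *)
have /orP[/eqP e|/eqP e] : (k 0 == k q) || (k o == k ord_max).
- rewrite -[k 0 == _]subr_eq0 -[k o == _]subr_eq0 -mulf_eq0 eq_le h /=.
  by apply: mulr_le0; rewrite subr_le0.
- exists (p ord_max), (k 0) => i Hi.
  have -> : l i = k (p^-1%g i) by rewrite /k /= permKV.
  have lt : (p^-1%g i <= m)%N.
    rewrite -ltnS ltn_neqAle -[(_ <= m.+1)%N]ltnS ltn_ord andbT.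
    apply: contra Hi => /eqP Hi; apply/eqP.
    by rewrite -(permKV p i); congr (p _); apply: val_inj.
  apply/eqP; rewrite eq_le; apply/andP; split; last by apply: Hp.
  by rewrite e; apply: Hp; rewrite qm.
- exists (p 0), (k o) => i Hi.
  have -> : l i = k (p^-1%g i) by rewrite /k /= permKV.
  have lt : (0 < p^-1%g i)%N.
    rewrite lt0n; apply: contra Hi => /eqP Hi; apply/eqP.
    by rewrite -(permKV p i); congr (p _); apply: val_inj.
  apply/eqP; rewrite eq_le; apply/andP; split; last by apply: Hp; rewrite o1.
  by rewrite e; apply: Hp; rewrite -ltnS.
Qed.

End Rigidity.

(** * Unitaries, spectral decomposition and trace formulas *)

Section Matrices.
Variable R : realType.
Local Open Scope complex_scope.
Implicit Types (n d : nat).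

Lemma adjmxM n (A B : 'M[R[i]]_n) : adjmx (A *m B) = adjmx B *m adjmx A.
Proof. by rewrite /adjmx map_mxM trmx_mul. Qed.

Lemma adjmxK n : involutive (@adjmx R n).
Proof. by move=> A; apply/matrixP => i j; rewrite !mxE conjcK. Qed.

Lemma adjmxD n (A B : 'M[R[i]]_n) : adjmx (A + B) = adjmx A + adjmx B.
Proof. by rewrite /adjmx map_mxD linearD. Qed.

Lemma adjmx_scalar n (x : R) : adjmx (x%:C%:M : 'M_n) = x%:C%:M.
Proof. by rewrite /adjmx map_scalar_mx tr_scalar_mx /= oppr0. Qed.

Lemma unitary1 n : unitary (1%:M : 'M[R[i]]_n).
Proof. by rewrite /unitary mul1mx (adjmx_scalar n 1). Qed.

Lemma unitary_adjK n (U : 'M[R[i]]_n) : unitary U -> adjmx U *m U = 1%:M.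
Proof. exact: mulmx1C. Qed.

Lemma unitary_mul n (U V : 'M[R[i]]_n) :
  unitary U -> unitary V -> unitary (U *m V).
Proof.
move=> hU hV; rewrite /unitary adjmxM mulmxA -[U *m V *m _]mulmxA.
by rewrite (hV : _ = _) mulmx1.
Qed.

Lemma unitary_adj n (U : 'M[R[i]]_n) : unitary U -> unitary (adjmx U).
Proof. by move=> hU; rewrite /unitary adjmxK unitary_adjK. Qed.

Lemma unitary_perm_mx n (s : 'S_n) : unitary (perm_mx s : 'M[R[i]]_n).
Proof.
by rewrite /unitary /adjmx map_perm_mx tr_perm_mx -perm_mxM mulgV perm_mx1.
Qed.

Lemma unitary_perm_basis n (V W : 'M[R[i]]_n) (s : 'S_n) :
  unitary V -> unitary W -> unitary (adjmx V *m perm_mx s *m W).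
Proof.
move=> hV hW; apply: unitary_mul => //; apply: unitary_mul.
  exact: unitary_adj.
exact: unitary_perm_mx.
Qed.

Lemma mxtrace_mul_adj_ge0 n (A : 'M[R[i]]_n) :
  0 <= complex.Re (\tr (A *m adjmx A)).
Proof.
have : 0 <= \tr (A *m adjmx A).
  apply: sumr_ge0 => i _; rewrite mxE; apply: sumr_ge0 => j _.
  by rewrite !mxE; exact: (@mul_conjC_ge0 R[i]).
by rewrite lecE => /andP[].
Qed.

Lemma mxtrace_unitary_conj n (U A : 'M[R[i]]_n) :
  unitary U -> \tr (U *m A *m adjmx U) = \tr A.
Proof. by move=> hU; rewrite -mulmxA mxtrace_mulC -mulmxA unitary_adjK ?mulmx1. Qed.

Definition real_diag n (l : 'I_n -> R) : 'M[R[i]]_n := diag_mx (\row_i (l i)%:C).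

Definition spectral_mx n (V : 'M[R[i]]_n) (l : 'I_n -> R) : 'M[R[i]]_n :=
  adjmx V *m real_diag l *m V.

Lemma hermitian_spectral n (A : 'M[R[i]]_n) : Defs.hermitian A ->
  exists V l, unitary V /\ A = spectral_mx V l.
Proof.
move=> hA; have hH : A \is hermsymmx.
  by apply/is_hermitianmxP; rewrite expr0 scale1r -map_trmx; exact/esym.
have /unitarymxP hV := spectral_unitarymx A.
(* The entries of [spectral_diag] are complex numbers, but real for Hermitian [A], so [Re] loses
   nothing. *)
exists (spectralmx A), (fun i => complex.Re (spectral_diag A 0 i)).
have hV' : unitary (spectralmx A) by rewrite /unitary /adjmx map_trmx.
split=> //; rewrite {1}(orthomx_spectralP (hermitian_normalmx hH)).
have -> : invmx (spectralmx A) = adjmx (spectralmx A).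
  rewrite -[LHS]mulmx1 -(hV' : _ = _) mulKmx //; exact: spectral_unit.
congr (_ *m diag_mx _ *m _); apply/rowP => i; rewrite mxE.
have /mxOverP/(_ 0 i) := hermitian_spectral_diag_real hH.
by case: (spectral_diag A 0 i) => a b /complex_realP[x ->].
Qed.

(** [U] matches the two eigenbases along [s], so [V] and [W] cancel and only the diagonals
    remain. *)
Lemma mxtrace_spectral_perm n (V W : 'M[R[i]]_n) (l k : 'I_n -> R) (s : 'S_n) :
  unitary V -> unitary W ->
  let U := adjmx V *m perm_mx s *m W in
  \tr (spectral_mx V l *m U *m spectral_mx W k *m adjmx U) =
    (\sum_i l i * k (s i))%:C.
Proof.
move=> hV hW U.
have -> : spectral_mx V l *m U *m spectral_mx W k *m adjmx U =
    adjmx V *m (real_diag l *m (perm_mx s *m real_diag k *m adjmx (perm_mx s)))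
      *m adjmx (adjmx V).
  rewrite /U /spectral_mx !adjmxM adjmxK !mulmxA.
  rewrite -[_ *m V *m adjmx V]mulmxA (hV : _ = _) mulmx1.
  rewrite -[_ *m W *m adjmx W]mulmxA (hW : _ = _) mulmx1.
  by rewrite -[_ *m W *m adjmx W]mulmxA (hW : _ = _) mulmx1.
rewrite mxtrace_unitary_conj; last exact: unitary_adj.
rewrite /adjmx map_perm_mx tr_perm_mx -row_permE -col_permE.
rewrite rmorph_sum; apply: eq_bigr => i _.
by rewrite /real_diag mul_diag_mx !mxE eqxx rmorphM.
Qed.

Lemma mxtrace_spectral n (V : 'M[R[i]]_n) (l : 'I_n -> R) :
  unitary V -> \tr (spectral_mx V l) = (\sum_i l i)%:C.
Proof.
move=> hV; rewrite /spectral_mx -{2}[V]adjmxK mxtrace_unitary_conj; last first.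
  exact: unitary_adj.
by rewrite mxtrace_diag rmorph_sum; apply: eq_bigr => i _; rewrite mxE.
Qed.

Lemma mxtrace_spectral_sqr n (V : 'M[R[i]]_n) (l : 'I_n -> R) :
  unitary V -> \tr (spectral_mx V l *m spectral_mx V l) = (\sum_i l i ^+ 2)%:C.
Proof.
move=> hV; have := mxtrace_spectral_perm l l 1 hV hV => /=.
rewrite perm_mx1 mulmx1 unitary_adjK // mulmx1 (adjmx_scalar n 1) mulmx1 => ->.
by congr (_%:C); apply: eq_bigr => i _; rewrite perm1 expr2.
Qed.

(** * From overlap bounds to the negativity *)

Section Negativity.
Variables (d : nat) (Q : 'I_(d ^ 2) -> 'M[R[i]]_d).
Hypothesis d_gt0 : (0 < d)%N.

(** The unnormalised entry of [UQ]: the factor [d] in [NU_unitary] cancels the division. *)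
Definition overlap (U : 'M[R[i]]_d) j k : R :=
  complex.Re (\tr (Q j *m U *m Q k *m adjmx U)).

Variable c : R.
Hypothesis overlap_ge : forall U j k, unitary U -> - c <= overlap U j k.

Let d0 : 0 < (d%:R : R). Proof. by rewrite ltr0n. Qed.

Let UQ_lbound U : unitary U ->
  lbound [set UQ Q U j k | j in setT & k in setT]%classic (- c / d%:R).
Proof.
move=> hU _ [j _ [k _ <-]]; rewrite /UQ ler_pM2r ?invr_gt0 //.
exact: overlap_ge.
Qed.

Let UQ_nonempty U : ([set UQ Q U j k | j in setT & k in setT] !=set0)%classic.
Proof.
have p : (0 < d ^ 2)%N by rewrite expn_gt0 d_gt0.
by exists (UQ Q U (Ordinal p) (Ordinal p)), (Ordinal p) => //; exists (Ordinal p).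
Qed.

Lemma NU_unitary_le U : unitary U -> NU_unitary Q U <= c.
Proof.
move=> hU; rewrite /NU_unitary lerNl.
have : - c / d%:R <= inf [set UQ Q U j k | j in setT & k in setT]%classic.
  by apply: lb_le_inf; [exact: UQ_nonempty | exact: UQ_lbound].
by rewrite ler_pdivrMr // mulrC.
Qed.

Lemma NU_le : NU Q <= c.
Proof.
apply: ge_sup.
  by exists (NU_unitary Q 1%:M), 1%:M => //; exact: unitary1.
by move=> _ [U hU <-]; exact: NU_unitary_le.
Qed.

(** The supremum dominates each [NU_unitary Q U] and the infimum lies below each entry. Both facts
    need bounded sets, which the a priori constant [c] supplies. *)
Lemma overlap_ge_NU U j k : unitary U -> - NU Q <= overlap U j k.
Proof.
move=> hU; rewrite lerNl; apply: (@le_trans _ _ (NU_unitary Q U)); last first.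
  apply: ub_le_sup; last by exists U.
  by exists c => _ [V hV <-]; exact: NU_unitary_le.
rewrite lerN2.
have : inf [set UQ Q U j k | j in setT & k in setT]%classic <= UQ Q U j k.
  apply: ge_inf; last by exists j => //; exists k.
  by exists (- c / d%:R); exact: UQ_lbound.
by rewrite /UQ ler_pdivlMr // mulrC.
Qed.

End Negativity.
End Matrices.

(** * The two bounds, and the overlaps of SIC families *)

Section Bounds.
Variable R : realType.
Local Open Scope complex_scope.

Section Overlap.
Variables (d : nat) (Q : 'I_(d ^ 2) -> 'M[R[i]]_d).
Hypothesis QQ : is_NQPR Q.

Lemma NQPR_overlap_ge U j k : (0 < d)%N -> unitary U ->
  - (d%:R - 2 / d%:R) <= overlap Q U j k.
Proof.
case: QQ => hQ [tQ oQ] d_gt0 hU.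
have d0 : (d%:R : R) != 0 by rewrite pnatr_eq0 -lt0n.
have dC0 : (d%:R : R[i]) != 0 by rewrite pnatr_eq0 -lt0n.
pose W := U *m Q k *m adjmx U.
have hW : adjmx W = W by rewrite /W !adjmxM adjmxK (hQ k : _ = _) mulmxA.
have tW : \tr W = 1 by rewrite mxtrace_unitary_conj.
have tWW : \tr (W *m W) = d%:R.
  have -> : W *m W = U *m (Q k *m Q k) *m adjmx U.
    by rewrite /W !mulmxA -[_ *m adjmx U *m U]mulmxA unitary_adjK ?mulmx1.
  by rewrite mxtrace_unitary_conj // oQ eqxx mulr1.
have tQQ : \tr (Q j *m Q j) = d%:R by rewrite oQ eqxx mulr1.
(* This scalar makes [Z] traceless, which minimises the trace of its square and gives the sharpest
   bound. *)
pose a : R := - (2 / d%:R).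
pose Z := Q j + W + a%:C%:M.
have hZ : adjmx Z = Z by rewrite /Z !adjmxD adjmx_scalar hW (hQ j : _ = _).
have := mxtrace_mul_adj_ge0 Z; rewrite hZ.
have -> : \tr (Z *m Z) = \tr (Q j *m W) *+ 2 + (2 * (d%:R - 2 / d%:R))%:C.
  rewrite /Z !(mulmxDl, mulmxDr) !mul_mx_scalar !mul_scalar_mx.
  rewrite !mxtraceD !mxtraceZ mxtrace_scalar tQ tW tWW tQQ.
  rewrite (mxtrace_mulC W) /a.
  rewrite !(rmorphB, rmorphM, rmorphN, fmorphV, rmorph_nat).
  by field.
rewrite /overlap /W !mulmxA.
by case: (\tr _) => x y; rewrite mulr2n /=; lra.
Qed.

Lemma NQPR_spectral j : exists V l,
  [/\ unitary V, Q j = spectral_mx V l, \sum_i l i = 1 & \sum_i l i ^+ 2 = d%:R].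
Proof.
case: QQ => hQ [tQ oQ].
have [V [l [hV E]]] := hermitian_spectral (hQ j).
exists V, l; split => //; apply: (@complexI R).
  by rewrite -(mxtrace_spectral l hV) -E tQ.
by rewrite -(mxtrace_spectral_sqr l hV) -E oQ eqxx mulr1 rmorph_nat.
Qed.

End Overlap.

Lemma NQPR_NU_bounds d (Q : 'I_(d ^ 2) -> 'M[R[i]]_d) :
  (2 <= d)%N -> is_NQPR Q -> 1 <= NU Q <= d%:R - 2 / d%:R.
Proof.
case: d Q => [|[|m]] // Q _ hQ.
have H U j k := @NQPR_overlap_ge _ Q hQ U j k isT.
apply/andP; split; last exact: NU_le.
have p : (0 < m.+2 ^ 2)%N by rewrite expn_gt0.
(* A single operator, here that of index 0, paired with itself already yields an overlap of at most
   -1. *)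
have [V [l [hV E s1 s2]]] := NQPR_spectral hQ (Ordinal p).
have [s] := perm_corr_le_N1 s1 s2.
pose U := adjmx V *m perm_mx s *m V.
have hU : unitary U by exact: unitary_perm_basis.
have := overlap_ge_NU (ltn0Sn _) H (Ordinal p) (Ordinal p) hU.
by rewrite /overlap E mxtrace_spectral_perm //= -/(perm_corr l s); lra.
Qed.

Lemma sqr_sqrt_dp1 d : (Num.sqrt (d%:R + 1) : R) ^+ 2 = d%:R + 1.
Proof. by rewrite sqr_sqrtr // addr_ge0. Qed.

(* The eigenvalue of [Q^+] ([e = 1]) or [Q^-] ([e = -1]) on the kernel of [Pi]. *)
Definition level d (e : R) : R := (1 + e * Num.sqrt (d%:R + 1)) / d%:R.

(** The quadratic is the one that the traces of [Q j] and its square impose on a repeated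
    eigenvalue. *)
Lemma level_quadratic d e : (0 < d)%N -> e ^+ 2 = 1 ->
  d%:R * level d e ^+ 2 - 2 * level d e = 1.
Proof.
move=> d_gt0 e2; have d0 : (d%:R : R) != 0 by rewrite pnatr_eq0 -lt0n.
set s := Num.sqrt (d%:R + 1) : R.
have -> : d%:R * level d e ^+ 2 - 2 * level d e = (e ^+ 2 * s ^+ 2 - 1) / d%:R.
  by rewrite /level -/s; field.
by rewrite e2 mul1r sqr_sqrt_dp1; field.
Qed.

Definition Qsign d (e : R) (Pi : 'I_(d ^ 2) -> 'M[R[i]]_d) j : 'M[R[i]]_d :=
  (- e * Num.sqrt (d%:R + 1))%:C *: Pi j + (level d e)%:C%:M.

Lemma Qsign1 d (Pi : 'I_(d ^ 2) -> 'M[R[i]]_d) : Qsign 1 Pi =1 Qplus Pi.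
Proof.
move=> j; rewrite /Qsign /level /Qplus /sqrt_dp1 mulN1r mul1r.
by rewrite !(rmorphD, rmorphM, rmorphN, fmorphV, rmorph_nat, rmorph1).
Qed.

Lemma QsignN1 d (Pi : 'I_(d ^ 2) -> 'M[R[i]]_d) : Qsign (-1) Pi =1 Qminus Pi.
Proof.
move=> j; rewrite /Qsign /level /Qminus /sqrt_dp1 opprK mulN1r mul1r.
by rewrite !(rmorphD, rmorphM, rmorphN, fmorphV, rmorph_nat, rmorph1).
Qed.

(** The terms linear and constant in the projectors add up to -1; the bilinear term is a square
    times the trace of [B *m adjmx B], hence nonnegative. *)
Lemma SIC_overlap_ge d (Q Pi : 'I_(d ^ 2) -> 'M[R[i]]_d) (e : R) U j k :
  (0 < d)%N -> is_SIC Pi -> e ^+ 2 = 1 -> Q =1 Qsign e Pi -> unitary U ->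
  -1 <= overlap Q U j k.
Proof.
move=> d_gt0 [hP [iP [_ oP]]] e2 QE hU.
have d0 : (d%:R : R) != 0 by rewrite pnatr_eq0 -lt0n.
have tP i : \tr (Pi i) = 1.
  by rewrite -(iP i) oP eqxx mulr1 divff // -[1]/(1%:R) -natrD pnatr_eq0 addn1.
set s := Num.sqrt (d%:R + 1) : R.
pose a := - e * s; pose b := level d e.
have Qa i : Q i = a%:C *: Pi i + b%:C%:M by rewrite QE.
pose B := Pi j *m U *m Pi k.
have EB : \tr (B *m adjmx B) = \tr (Pi j *m U *m Pi k *m adjmx U).
  rewrite /B !adjmxM (hP j : _ = _) (hP k : _ = _) !mulmxA.
  rewrite -[_ *m Pi k *m Pi k]mulmxA iP mxtrace_mulC !mulmxA iP.
  by [].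
have ge0 := mxtrace_mul_adj_ge0 B; rewrite EB in ge0.
rewrite /overlap.
have -> : \tr (Q j *m U *m Q k *m adjmx U) =
  (a ^+ 2)%:C * \tr (Pi j *m U *m Pi k *m adjmx U) + (2 * a * b + d%:R * b ^+ 2)%:C.
  rewrite !Qa !(mulmxDl, mulmxDr) -!(scalemxAl, scalemxAr) !mul_mx_scalar.
  rewrite -!(scalemxAl, scalemxAr) !mul_scalar_mx -!(scalemxAl, scalemxAr).
  rewrite (hU : _ = _) -[Pi j *m U *m adjmx U]mulmxA (hU : _ = _) mulmx1.
  have tUP : \tr (U *m Pi k *m adjmx U) = 1 by rewrite mxtrace_unitary_conj.
  move: (Pi j *m U *m Pi k *m adjmx U) => X.
  move: (U *m Pi k *m adjmx U) tUP (Pi j) (tP j) => Y tY Z tZ.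
  rewrite !mxtraceD !mxtraceZ mxtrace1 tY tZ.
  rewrite !(rmorphD, rmorphM, rmorphXn, rmorph_nat).
  by ring.
have -> : 2 * a * b + d%:R * b ^+ 2 = -1.
  (* [a = 1 - d b], so this is the quadratic equation for [b]. *)
  have -> : a = 1 - d%:R * b by rewrite /a /b /level -/s; field.
  have -> : 2 * (1 - d%:R * b) * b + d%:R * b ^+ 2 =
    - (d%:R * b ^+ 2 - 2 * b) by ring.
  by rewrite level_quadratic.
move: ge0; case: (\tr _) => x y /= x0.
have : 0 <= a ^+ 2 * x by rewrite mulr_ge0 // sqr_ge0.
by rewrite mul0r subr0; lra.
Qed.

End Bounds.

(** * The equality case *)

Section Equality.
Variable R : realType.
Local Open Scope complex_scope.

Lemma sum_all_but_one n (f : 'I_n.+1 -> R) i0 y :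
  (forall i, i != i0 -> f i = y) -> \sum_i f i = f i0 + n%:R * y.
Proof.
move=> h; rewrite (bigD1 i0) //=; congr (_ + _).
rewrite (eq_bigr (fun=> y)) // sumr_const (cardC1 i0) card_ord /=.
by rewrite mulr_natl.
Qed.

(** Equivalently, [A] is Hermitian and differs from [y] times the identity by rank at most one; the
    eigenvalue at [i0] is unconstrained. *)
Definition near_scalar n (y : R) (A : 'M[R[i]]_n) : Prop :=
  exists V l i0, [/\ unitary V, A = spectral_mx V l & forall i, i != i0 -> l i = y].

(** The trace determines the exceptional eigenvalue, and [P] projects onto its eigenvector. *)
Lemma near_scalar_proj d (A : 'M[R[i]]_d) (e : R) :
  \tr A = 1 -> near_scalar (level d e) A ->
  exists P : 'M[R[i]]_d, [/\ Defs.hermitian P, P *m P = P, \rank P = 1%N &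
    A = (- e * Num.sqrt (d%:R + 1))%:C *: P + (level d e)%:C%:M].
Proof.
case: d A => [|n] A tA [V [l [i0 [hV AE hl]]]]; first by case: i0 {hl}.
exists (adjmx V *m delta_mx i0 i0 *m V); split.
- rewrite /Defs.hermitian !adjmxM adjmxK mulmxA; congr (_ *m _ *m _).
  apply/matrixP => i j; rewrite !mxE andbC.
  by case: (_ && _); rewrite /= oppr0.
- rewrite !mulmxA -[_ *m V *m adjmx V]mulmxA (hV : _ = _) mulmx1.
  by rewrite -[_ *m delta_mx _ _ *m delta_mx _ _]mulmxA mul_delta_mx.
- have /mulmx1_unit[uV uV'] := hV : V *m adjmx V = 1%:M.
  rewrite mxrankMfree ?row_free_unit // eqmxMfull ?row_full_unit //.
  exact: mxrank_delta.
- have d0 : (n.+1%:R : R) != 0 by rewrite pnatr_eq0.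
  have s1 : \sum_i l i = 1.
    by apply: (@complexI R); rewrite -(mxtrace_spectral l hV) -AE tA.
  have li0 : l i0 = level n.+1 e - e * Num.sqrt (n.+1%:R + 1).
    move: s1; rewrite (sum_all_but_one hl) /level -[n.+1%:R]natr1 => /eqP.
    rewrite -subr_eq0 => /eqP E; apply/eqP; rewrite -subr_eq0 -[X in _ == X]E.
    apply/eqP.
    by field; rewrite natr1.
  rewrite AE /spectral_mx.
  have -> : real_diag l = (- e * Num.sqrt (n.+1%:R + 1))%:C *: delta_mx i0 i0
      + (level n.+1 e)%:C%:M.
    apply/matrixP => i j; rewrite !mxE.
    have [<-{j}|ij] := eqVneq i j; last first.
      have -> : (i == i0) && (j == i0) = false.
        by apply/negP => /andP[/eqP a /eqP b]; move: ij; rewrite a b eqxx.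
      by rewrite !mulr0n mulr0 addr0.
    rewrite andbb !mulr1n; have [->|ii] := eqVneq i i0.
      by rewrite mulr1 -rmorphD li0 mulNr addrC.
    by rewrite mulr0 add0r hl.
  rewrite mulmxDr mulmxDl -scalemxAr -scalemxAl; congr (_ + _).
  by rewrite mul_mx_scalar -scalemxAl unitary_adjK // scalemx1.
Qed.

(** With [M = d - 1] the left side is the overlap of two spectra of opposite sign whose exceptional
    eigenvalues are aligned; the right side is [- d + 2 / d]. *)
Lemma opposite_levels_corr (M s : R) : M + 1 != 0 -> s ^+ 2 = M + 1 + 1 ->
  (1 - M * ((1 + s) / (M + 1))) * (1 - M * ((1 - s) / (M + 1))) +
    M * ((1 + s) / (M + 1) * ((1 - s) / (M + 1))) = 1 - M - 2 * M / (M + 1).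
Proof.
move=> M1 s2.
have -> : (1 - M * ((1 + s) / (M + 1))) * (1 - M * ((1 - s) / (M + 1))) +
    M * ((1 + s) / (M + 1) * ((1 - s) / (M + 1))) =
    1 - 2 * M / (M + 1) + M * (1 - s ^+ 2) / (M + 1) by field.
by rewrite s2; field.
Qed.

Section Minimal.
Variables (m : nat) (Q : 'I_(m.+2 ^ 2) -> 'M[R[i]]_m.+2).
Hypotheses (hQ : is_NQPR Q) (NU1 : NU Q = 1).

Local Notation dR := (m.+2%:R : R).

(** Taking [j = k] gives the rigidity of one spectrum; distinct indices serve to compare signs. *)
Lemma spectral_corr_ge j k V W l l' (s : 'S_m.+2) :
  unitary V -> unitary W -> Q j = spectral_mx V l -> Q k = spectral_mx W l' ->
  -1 <= \sum_i l i * l' (s i).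
Proof.
move=> hV hW Ej Ek; pose U := adjmx V *m perm_mx s *m W.
have hU : unitary U by exact: unitary_perm_basis.
have H U' j' k' := @NQPR_overlap_ge _ _ Q hQ U' j' k' isT.
have := overlap_ge_NU (ltn0Sn _) H j k hU.
by rewrite NU1 /overlap Ej Ek mxtrace_spectral_perm.
Qed.

Lemma NQPR_near_scalar j :
  near_scalar (level m.+2 1) (Q j) \/ near_scalar (level m.+2 (-1)) (Q j).
Proof.
have [V [l [hV E s1 s2]]] := NQPR_spectral hQ j.
have [i0 [y hl]] : exists i0 y, forall i, i != i0 -> l i = y.
  by apply: all_but_one_eq => // s; exact: (spectral_corr_ge s hV hV E E).
pose M : R := m.+1%:R.
have M0 : M != 0 by rewrite pnatr_eq0.
have dM : dR = M + 1 by rewrite natr1.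
have d0 : dR != 0 by rewrite pnatr_eq0.
have x1 : l i0 = 1 - M * y by rewrite -s1 (sum_all_but_one hl) addrK.
have x2 : l i0 ^+ 2 + M * y ^+ 2 = dR.
  rewrite -s2 (@sum_all_but_one _ (fun i => l i ^+ 2) i0 (y ^+ 2)) // => i Hi.
  by rewrite hl.
(* Eliminating [l i0] from the two trace conditions leaves a multiple of [M], which is divided
   out. *)
have y2 : dR * y ^+ 2 - 2 * y = 1.
  apply: (mulfI M0); move: x2; rewrite x1 dM => x2.
  have -> : M * ((M + 1) * y ^+ 2 - 2 * y) =
      (1 - M * y) ^+ 2 + M * y ^+ 2 - 1 by ring.
  by rewrite x2; ring.
set s := Num.sqrt (dR + 1).
have s2' : s ^+ 2 = dR + 1 by exact: sqr_sqrt_dp1.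
have : (dR * y - 1 - s) * (dR * y - 1 + s) = 0.
  have -> : (dR * y - 1 - s) * (dR * y - 1 + s) =
     dR * (dR * y ^+ 2 - 2 * y) + 1 - s ^+ 2 by ring.
  by rewrite y2 s2'; ring.
move=> /eqP; rewrite mulf_eq0 => /orP[] /eqP hy; [left|right];
  exists V, l, i0; split=> // i /hl ->; rewrite /level -/s; apply: (mulfI d0).
- by rewrite mulrC -[dR * _]mulrC divfK // mulrC; lra.
- by rewrite mulrC -[dR * _]mulrC divfK // mulrC; lra.
Qed.

Lemma near_scalar_same_sign j k : (0 < m)%N ->
  near_scalar (level m.+2 1) (Q j) -> near_scalar (level m.+2 (-1)) (Q k) -> False.
Proof.
move=> m0 [V [l [i0 [hV Ej hl]]]] [W [l' [i1 [hW Ek hl']]]].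
case: hQ => _ [tQ _].
have s1 : \sum_i l i = 1.
  by apply: (@complexI R); rewrite -(mxtrace_spectral l hV) -Ej tQ.
have s1' : \sum_i l' i = 1.
  by apply: (@complexI R); rewrite -(mxtrace_spectral l' hW) -Ek tQ.
(* The transposition aligns the two exceptional eigenvalues; all other pairs contribute [y * y']. *)
have := spectral_corr_ge (tperm i0 i1) hV hW Ej Ek.
set y := level _ _ in hl; set y' := level _ _ in hl'.
rewrite (@sum_all_but_one _ _ i0 (y * y')); last first.
  move=> i ii; rewrite hl // hl' //.
  by rewrite -(inj_eq (@perm_inj _ (tperm i0 i1))) tpermK tpermR.
rewrite tpermL.
pose M : R := m.+1%:R.
have dM : dR = M + 1 by rewrite natr1.
have d0 : M + 1 != 0 by rewrite -dM pnatr_eq0.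
have -> : l i0 = 1 - M * y by rewrite -s1 (sum_all_but_one hl) addrK.
have -> : l' i1 = 1 - M * y' by rewrite -s1' (sum_all_but_one hl') addrK.
rewrite -/M /y /y' /level mulN1r mul1r dM.
rewrite opposite_levels_corr //; last by rewrite -dM sqr_sqrt_dp1.
(* Here [0 < m] enters: for [M >= 2] the overlap falls strictly below -1. *)
have M2 : (2 : R) <= M by rewrite ler_nat.
have : 0 < 2 * M / (M + 1) by rewrite divr_gt0 //; lra.
by lra.
Qed.

(* In dimension 2 the two eigenvalues are interchangeable. *)
Lemma near_scalar_dim2 j : m = 0%N ->
  near_scalar (level m.+2 1) (Q j) -> near_scalar (level m.+2 (-1)) (Q j).
Proof.
move=> m0 [V [l [i0 [hV Ej hl]]]]; case: hQ => _ [tQ _].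
have s1 : \sum_i l i = 1.
  by apply: (@complexI R); rewrite -(mxtrace_spectral l hV) -Ej tQ.
exists V, l, (rev_ord i0); split=> // i Hi.
have -> : i = i0.
  apply: val_inj; move: Hi (ltn_ord i) (ltn_ord i0); rewrite -val_eqE /=.
  move: (nat_of_ord i) (nat_of_ord i0) => a b; rewrite m0.
  by case: a => [|[|a]] //; case: b => [|[|b]].
move: s1; rewrite (sum_all_but_one hl) /level m0 mul1r => s1; lra.
Qed.

(** In dimension at least 3 the sign at index 0 forces all others; in dimension 2 every operator can
    be read with sign -1. *)
Lemma NQPR_common_sign : exists e : R, (e = 1 \/ e = -1) /\
  forall j, near_scalar (level m.+2 e) (Q j).
Proof.
have [m0|m0] := posnP m.
  exists (-1); split; first by right.
  by move=> j; case: (NQPR_near_scalar j) => // /(near_scalar_dim2 m0).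
have p : (0 < m.+2 ^ 2)%N by rewrite expn_gt0.
have [h|h] := NQPR_near_scalar (Ordinal p).
  exists 1; split; first by left.
  move=> j; case: (NQPR_near_scalar j) => // h'.
  by case: (near_scalar_same_sign m0 h h').
exists (-1); split; first by right.
move=> j; case: (NQPR_near_scalar j) => // h'.
by case: (near_scalar_same_sign m0 h' h).
Qed.

(** Solving the affine relation for the projectors turns the orthogonality of the [Q j] into the SIC
    relation, since [a ^+ 2 = d + 1] and [b] satisfies [level_quadratic]. *)
Lemma NQPR_SIC : exists (e : R) (Pi : 'I_(m.+2 ^ 2) -> 'M[R[i]]_m.+2),
  [/\ e = 1 \/ e = -1, is_SIC Pi & Q =1 Qsign e Pi].
Proof.
have [e [he hN]] := NQPR_common_sign; case: (hQ) => _ [tQ oQ].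
have e2 : e ^+ 2 = 1 by case: he => ->; ring.
have /fin_all_exists[Pi hPi] j := near_scalar_proj (tQ j) (hN j).
exists e, Pi; split=> //; last by move=> j; case: (hPi j).
split; first by move=> j; case: (hPi j).
split; first by move=> j; case: (hPi j).
split; first by move=> j; case: (hPi j).
move=> j k; set s : R := Num.sqrt (m.+2%:R + 1).
have s2 : s ^+ 2 = dR + 1 by exact: sqr_sqrt_dp1.
have dp0 : dR + 1 != 0 by rewrite natr1 pnatr_eq0.
pose a := - e * s; pose b := level m.+2 e.
have a2 : a ^+ 2 = dR + 1 by rewrite /a exprMn sqrrN e2 mul1r.
have a0 : a != 0 by rewrite -sqrf_eq0 a2.
have PE i : Pi i = a^-1%:C *: (Q i - b%:C%:M).
  by case: (hPi i) => _ _ _ ->; rewrite addrK scalerA -rmorphM mulVf // scale1r.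
have -> : \tr (Pi j *m Pi k) =
    (a ^+ 2)^-1%:C * (\tr (Q j *m Q k) + (dR * b ^+ 2 - 2 * b)%:C).
  rewrite !PE -scalemxAl -scalemxAr scalerA mxtraceZ -rmorphM -invfM -expr2.
  congr (_ * _); rewrite !(mulmxBl, mulmxBr) mul_mx_scalar !mul_scalar_mx.
  rewrite !raddfB /= !mxtraceZ mxtrace_scalar !tQ.
  rewrite !(rmorphB, rmorphM, rmorphXn, rmorph_nat).
  by ring.
rewrite level_quadratic //.
by rewrite a2 oQ fmorphV rmorphD rmorph_nat mulrC.
Qed.

End Minimal.
End Equality.

Theorem theorem3 (R : realType) (d : nat) (Q : 'I_(d ^ 2) -> 'M[R[i]]_d) :
  (2 <= d)%N -> is_NQPR Q ->
  (1 <= NU Q /\ NU Q <= d%:R - 2 / d%:R) /\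
  (NU Q = 1 <->
     exists Pi : 'I_(d ^ 2) -> 'M[R[i]]_d,
       is_SIC Pi /\ ((forall j, Q j = Qminus Pi j) \/ (forall j, Q j = Qplus Pi j))).
Proof.
move=> d2 hQ; have /andP[lo hi] := NQPR_NU_bounds d2 hQ.
split=> //; split.
  case: d Q d2 hQ lo hi => [|[|m]] // Q _ hQ _ _ NU1.
  have [e [Pi [he hP QE]]] := NQPR_SIC hQ NU1; exists Pi; split=> //.
  case: he QE => -> QE; [right|left] => j; rewrite QE.
    exact: Qsign1.
  exact: QsignN1.
case=> Pi [hP hE].
have [e [e2 QE]] : exists e : R, e ^+ 2 = 1 /\ Q =1 Qsign e Pi.
  case: hE => E.
    by exists (-1); split=> [|j]; rewrite ?sqrrN ?expr1n ?QsignN1.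
  by exists 1; split=> [|j]; rewrite ?expr1n ?Qsign1.
apply/eqP; rewrite eq_le lo andbT.
have d0 : (0 < d)%N by apply: leq_trans d2.
(* Only [NU Q <= 1] remains, which is the case [c = 1]. *)
by apply: NU_le => // U j k hU; exact: (SIC_overlap_ge j k d0 hP e2 QE hU).
Qed.
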